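(* Let $c\ge 1$ be an integer and let $\mathcal{M}=\{M_j\}_{j\in J}$ be a finite nonempty collection of monomials $M_j=x_0^{c}x_1^{a_{1,j}}\cdots x_n^{a_{n,j}}\in\mathbb{C}[x_0,\ldots,x_n]$ with $a_{i,j}\ge c$ for every $i,j$. Assume that $\mathcal{M}$ is a free collection. For $\{j_1,\ldots,j_k\}\subseteq J$ let $M_{j_1,\ldots,j_k}=\gcd(M_{j_1},\ldots,M_{j_k})$. Then $$\mathrm{rk}_{\mathbb{C}}\,\mathcal{M}=\sum_{\emptyset\ne\{j_1,\ldots,j_k\}\subseteq J}(-1)^{k+1}\,\mathrm{rk}_{\mathbb{C}}\,M_{j_1,\ldots,j_k},$$ where the sum is over all nonempty subsets of $J$ and $k$ denotes the cardinality of the subset.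
   Context: Here $n$ is a nonnegative integer, and a form is a homogeneous polynomial. For a finite collection of forms $\mathcal{F}=\{F_1,\ldots,F_s\}$ in $S=\mathbb{C}[x_0,\ldots,x_n]$ (degrees not necessarily equal), the simultaneous Waring rank $\mathrm{rk}_{\mathbb{C}}\,\mathcal{F}$ is the minimal integer $r$ such that there exist linear forms $L_1,\ldots,L_r\in S$ with the property that every $F_i$ can be written as $F_i=\sum_{j=1}^r\lambda_{i,j}L_j^{d_i}$ with $d_i=\deg F_i$ and $\lambda_{i,j}\in\mathbb{C}$. For a single form, $\mathrm{rk}_{\mathbb{C}}\,F=\mathrm{rk}_{\mathbb{C}}\{F\}$ is the usual complex Waring rank. Free collections: let $\mathcal{M}=\{M_j\}_{j\in J}$ with $M_j=x_0^{c}x_1^{a_{1,j}}\cdots x_n^{a_{n,j}}$. For each $1\le i\le n$, order linearly the exponents of $x_i$ appearing in the monomials of $\mathcal{M}$ as $a_{i,k_1}\le a_{i,k_2}\le\cdots\le a_{i,k_{|J|}}$ (with repetitions), and let $\mathcal{D}_i$ be the multiset of differences $a_{i,k_{s+1}}-a_{i,k_s}$ of successive elements. The collection $\mathcal{M}$ is $(1,1)$-free if, for every $i\in\{1,\ldots,n\}$, the multiset $\mathcal{D}_i$ contains $1$ at most one time. The collection $\mathcal{M}$ is free if it is $(1,1)$-free and, for every $i$, the multiset $\mathcal{D}_i$ does not contain nonzero integers smaller than or equal to $c$. *)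

(* Defs.v *)
From HB Require Import structures.
From mathcomp Require Import all_boot all_order all_algebra.
From mathcomp Require Import boolp reals complex.
From mathcomp Require Export mpoly.

Set Implicit Arguments.
Unset Strict Implicit.
Unset Printing Implicit Defensive.

Import Order.TTheory GRing.Theory Num.Theory.
Local Open Scope ring_scope.

(* A family [F] of forms is allowed to have repetitions.  The degree of a form
   [F i] is [(msize (F i)).-1]; for [F i = 0] this is [0], which is harmless
   since the zero form imposes no condition. *)
Definition waring_decomposable (K : fieldType) (N : nat) (I : finType)
    (F : I -> {mpoly K[N]}) (r : nat) : Prop :=
  exists (L : 'I_r -> {mpoly K[N]}) (lambda : I -> 'I_r -> K),
    (forall k, L k \is 1.-homog) /\
    (forall i, F i = \sum_(k < r) lambda i k *: L k ^+ (msize (F i)).-1).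

(* The value [0] in the second branch is never used for forms over the complex
   numbers: see [simultaneous_waring_rankP]. *)
Definition simultaneous_waring_rank (K : fieldType) (N : nat) (I : finType)
    (F : I -> {mpoly K[N]}) : nat :=
  if pselect (exists r, `[< waring_decomposable F r >]) is left ex
  then ex_minn ex else 0%N.

Definition waring_rank (K : fieldType) (N : nat) (F : {mpoly K[N]}) : nat :=
  simultaneous_waring_rank (fun _ : unit => F).

Section RankExists.
Variables (K : numFieldType) (N : nat).
Implicit Types (P Q L : {mpoly K[N]}) (d : nat).

Let power_sum d P := exists s : seq (K * {mpoly K[N]}),
  all (fun x => x.2 \is 1.-homog) s /\ P = \sum_(x <- s) x.1 *: x.2 ^+ d.

Let power_sumD d P Q : power_sum d P -> power_sum d Q -> power_sum d (P + Q).
Proof.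
move=> [s [hs ->]] [t [ht ->]]; exists (s ++ t).
by rewrite all_cat hs ht big_cat.
Qed.

Let power_sumZ d a P : power_sum d P -> power_sum d (a *: P).
Proof.
move=> [s [hs ->]]; exists [seq (a * x.1, x.2) | x <- s].
split; first by rewrite all_map; apply: sub_all hs.
by rewrite big_map scaler_sumr; apply: eq_bigr => x _; rewrite scalerA.
Qed.

Let power_sum_sum d (I : eqType) (r : seq I) (G : I -> {mpoly K[N]}) :
  (forall i, i \in r -> power_sum d (G i)) -> power_sum d (\sum_(i <- r) G i).
Proof.
elim: r => [|i r IH] h; first by exists [::]; rewrite !big_nil.
rewrite big_cons; apply: power_sumD; first by apply: h; rewrite mem_head.
by apply: IH => j hj; apply: h; rewrite in_cons hj orbT.
Qed.

Let power_sum_pow d L : L \is 1.-homog -> power_sum d (L ^+ d).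
Proof. by move=> hL; exists [:: (1, L)]; rewrite /= hL big_seq1 scale1r. Qed.

Let vander d : exists w : 'I_d.+2 -> K, forall k : 'I_d.+2,
  \sum_(j < d.+2) w j * j%:R ^+ k = (k == 1%N :> nat)%:R.
Proof.
pose V := Vandermonde d.+2 (\row_(j < d.+2) (j%:R : K)).
have Vu : V \in unitmx.
  rewrite unitmxE det_Vandermonde unitfE; apply/prodf_neq0 => i _.
  apply/prodf_neq0 => j ltij.
  by rewrite !mxE subr_eq0 eqr_nat neq_ltn ltij orbT.
pose w : 'cV[K]_d.+2 := invmx V *m delta_mx 1 0.
exists (fun j => w j 0) => k.
have /matrixP/(_ k 0) : V *m w = delta_mx 1 0 by rewrite mulKVmx.
rewrite !mxE andbT => <-; apply: eq_bigr => j _.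
by rewrite !mxE mulrC.
Qed.

Let power_sum_mulX d i P : power_sum d P -> power_sum d.+1 ('X_i * P).
Proof.
move=> [s [hs ->]]; rewrite mulr_sumr.
apply: power_sum_sum => -[a L] /(allP hs) /= hL.
rewrite -scalerAr; apply: power_sumZ.
have [w hw] := vander d.
have -> : 'X_i * L ^+ d = (d.+1%:R)^-1 *:
   \sum_(j < d.+2) w j *: (L + j%:R *: 'X_i) ^+ d.+1.
  transitivity ((d.+1%:R : K)^-1 *: \sum_(k < d.+2)
     (\sum_(j < d.+2) w j * j%:R ^+ k) *: ((L ^+ (d.+1 - k) * 'X_i ^+ k) *+ 'C(d.+1, k))).
    rewrite (bigD1 (inord 1)) //= [X in _ + X]big1 => [|k nk].
      rewrite addr0 hw inordK // eqxx scale1r subSS subn0 expr1 bin1.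
      by rewrite -scaler_nat scalerA mulVf ?pnatr_eq0 // scale1r mulrC.
    rewrite hw; case: eqP => [k1|]; last by rewrite scale0r.
    by case/eqP: nk; apply: val_inj; rewrite /= inordK.
  congr (_ *: _); under eq_bigr => k _ do rewrite scaler_suml.
  rewrite exchange_big; apply: eq_bigr => j _ /=.
  rewrite exprDn scaler_sumr; apply: eq_bigr => k _.
  by rewrite exprZn -scalerAr -scalerA scalerMnr.
apply/power_sumZ/power_sum_sum => j _; apply/power_sumZ/power_sum_pow.
by apply: rpredD => //; apply: rpredZ; rewrite dhomogX /= mdeg1.
Qed.

Let power_sum_monom d m : mdeg m = d -> power_sum d 'X_[m].
Proof.
elim: d m => [|d IH] m hm.
  have -> : m = 0%MM by apply/eqP; rewrite -mdeg_eq0 hm.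
  by rewrite mpolyX0; exists [:: (1, 0)]; rewrite /= rpred0 big_seq1 scale1r expr0.
have [i hi] : exists i, (0 < m i)%N.
  apply/existsP; apply: contra_eqT hm => /existsPn h.
  by rewrite mdegE big1 // => i _; apply/eqP; rewrite -leqn0 leqNgt.
have le1 : (U_(i) <= m)%MM.
  by apply/mnm_lepP => j; rewrite mnm1E; case: eqP => // <-.
have mE : (U_(i) + (m - U_(i)))%MM = m by rewrite addmC submK.
rewrite -mE mpolyXD; apply/power_sum_mulX/IH.
by move: hm; rewrite -{1}mE mdegD mdeg1 add1n => -[].
Qed.

Let power_sum_homog d P : P \is d.-homog -> power_sum d P.
Proof.
move=> /dhomogP hP; rewrite [P]mpolyE; apply: power_sum_sum => m hm.
by apply/power_sumZ/power_sum_monom/hP.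
Qed.

Lemma waring_decomposable_ex (I : finType) (F : I -> {mpoly K[N]}) :
  (forall i, F i \is homog mdeg) -> exists r, waring_decomposable F r.
Proof.
move=> hF.
have /choice[s hs] : forall i, exists si : seq (K * {mpoly K[N]}),
    all (fun x => x.2 \is 1.-homog) si /\
    F i = \sum_(x <- si) x.1 *: x.2 ^+ (msize (F i)).-1.
  by move=> i; apply: power_sum_homog; apply: hF.
pose T : finType := {i : I & 'I_(size (s i))}.
pose x0 : K * {mpoly K[N]} := (0, 0).
pose L (t : T) := (nth x0 (s (tag t)) (tagged t)).2.
pose mu i (t : T) := if tag t == i then (nth x0 (s (tag t)) (tagged t)).1 else 0.
exists #|T|, (fun k : 'I_#|T| => L (enum_val k)), (fun i (k : 'I_#|T|) => mu i (enum_val k)).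
split.
  by move=> k; have [/allP h _] := hs (tag (enum_val k)); apply/h/mem_nth.
move=> i; have [_ {1}->] := hs i.
set d := (msize _).-1.
transitivity (\sum_(t : T) mu i t *: L t ^+ d); last first.
  apply: (reindex (enum_val : 'I_#|T| -> T)); exact/onW_bij/enum_val_bij.
pose G i' (k : 'I_(size (s i'))) :=
  (if i' == i then (nth x0 (s i') k).1 else 0) *: (nth x0 (s i') k).2 ^+ d.
rewrite -(sig_big_dep xpredT (fun _ _ => true) G) /=.
rewrite (bigD1 i) //= [X in _ + X]big1 ?addr0 => [|i' /negbTE ne]; last first.
  by apply: big1 => k _; rewrite /G ne scale0r.
rewrite (big_nth x0) big_mkord; apply: eq_bigr => k _.
by rewrite /G eqxx.
Qed.

Lemma simultaneous_waring_rankP (I : finType) (F : I -> {mpoly K[N]}) :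
  (forall i, F i \is homog mdeg) ->
  waring_decomposable F (simultaneous_waring_rank F) /\
  (forall r, waring_decomposable F r -> (simultaneous_waring_rank F <= r)%N).
Proof.
move=> /waring_decomposable_ex[r0 hr0]; rewrite /simultaneous_waring_rank.
case: pselect => [ex|[]]; last by exists r0; apply/asboolP.
case: ex_minnP => r /asboolP hr rmin.
by split=> // r' hr'; apply: rmin; apply/asboolP.
Qed.

End RankExists.

(* The [\max] is only the neutral value of the iterated minimum; for empty [A]
   the result is [0%MM]. *)
Definition mgcd (N : nat) (J : finType) (A : {set J})
    (m : J -> 'X_{1..N}) : 'X_{1..N} :=
  [multinom \big[minn/(\max_(k in A) m k i)]_(j in A) m j i | i < N].

Lemma mgcdP (N : nat) (J : finType) (A : {set J}) (m : J -> 'X_{1..N})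
    (d : 'X_{1..N}) : A != set0 ->
  (d <= mgcd A m)%MM <-> (forall j, j \in A -> (d <= m j)%MM).
Proof.
move=> /set0Pn[j0 j0A]; split=> [h j jA | h].
  apply/mnm_lepP => i; apply: leq_trans (mnm_lepP h i) _.
  by rewrite mnmE -leEnat -minEnat; apply: bigmin_le_cond.
apply/mnm_lepP => i; rewrite mnmE.
apply: (big_ind (fun x => d i <= x)%N) => [|x y hx hy|j jA].
- by rewrite (bigD1 j0) //= leq_max (mnm_lepP (h _ j0A) i).
- by rewrite leq_min hx.
- exact: (mnm_lepP (h _ jA) i).
Qed.

Lemma monomial_divisor (K : fieldType) (N : nat) (k : 'X_{1..N})
    (P Q : {mpoly K[N]}) : 'X_[k] = P * Q ->
  exists a c, c != 0 /\ P = c *: 'X_[a].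
Proof.
move=> e; have X0 : 'X_[k] != 0 :> {mpoly K[N]} by rewrite -msupp_eq0 msuppX.
have P0 : P != 0 by apply: contraNneq X0 => P0; rewrite e P0 mul0r.
have Q0 : Q != 0 by apply: contraNneq X0 => Q0; rewrite e Q0 mulr0.
have last0 (S : {mpoly K[N]}) : S != 0 -> S@_(mlast S) != 0.
  by move=> S0; rewrite mcoeff_eq0 negbK mlast_supp.
have lastM : (P * Q)@_(mlast P + mlast Q) = P@_(mlast P) * Q@_(mlast Q).
  rewrite mpolyME (bigD1_seq (mlast P, mlast Q)) /=; first last.
  - by rewrite allpairs_uniq => // -[? ?] [].
  - by rewrite allpairs_f // !mlast_supp.
  rewrite mcoeffD mcoeffZ mcoeffX eqxx mulr1.
  rewrite big_seq_cond raddf_sum /= big1 ?addr0 //.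
  case=> _ _ /andP[/allpairsP[[m1 m2] [/= h1 h2 [-> ->]]] ne].
  have [le1 le2] := (mlast_lemc h1, mlast_lemc h2).
  rewrite mcoeffZ mcoeffX.
  move: le2; rewrite le_eqVlt => /predU1P[E2|lt2]; last first.
    by rewrite gt_eqF ?mulr0 // lemc_lt_add.
  move: ne; rewrite -E2 xpair_eqE eqxx andbT => ne1.
  by rewrite eqm_add2r (negbTE ne1) mulr0.
have kE : k = (mlead P + mlead Q)%MM by rewrite -mleadM // -e mleadXm.
have kE' : k = (mlast P + mlast Q)%MM.
  apply/eqP; apply: contraNT (mulf_neq0 (last0 _ P0) (last0 _ Q0)) => /negbTE ne.
  by rewrite -lastM -e mcoeffX ne.
have PE : mlast P = mlead P.
  apply/eqP; rewrite eq_le mlast_lemc ?mlead_supp //= leNgt; apply/negP => lt.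
  have : (k < k)%O.
    by rewrite {1}kE' kE; apply: ltmc_le_add => //; rewrite mlast_lemc ?mlead_supp.
  by rewrite ltxx.
exists (mlead P), (P@_(mlead P)); split; first by rewrite mleadc_eq0.
apply/mpolyP => x; rewrite mcoeffZ mcoeffX.
have [<-|ne] := eqVneq; first by rewrite mulr1.
rewrite mulr0; have [lt|lt] := ltP x (mlead P).
  by apply: mcoeff_lt_mlast; rewrite PE.
by apply: mcoeff_gt_mlead; rewrite lt_neqAle ne.
Qed.

Lemma mpolyX_gcdP (K : fieldType) (N : nat) (J : finType) (A : {set J})
    (m : J -> 'X_{1..N}) (P : {mpoly K[N]}) : A != set0 ->
  (exists Q, 'X_[mgcd A m] = P * Q) <->
  (forall j, j \in A -> exists Q, 'X_[m j] = P * Q).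
Proof.
move=> A0; split=> [[Q hQ] j jA | h].
  have le := iffLR (mgcdP m _ A0) (lepm_refl _) j jA.
  by exists (Q * 'X_[m j - mgcd A m]); rewrite mulrA -hQ -mpolyXD addmC submK.
have [/set0Pn[j0 j0A]] := A0.
have [Q0 eQ0] := h j0 j0A.
have [a [c [c0 PE]]] := monomial_divisor eQ0.
have hd : (a <= mgcd A m)%MM.
  apply/(mgcdP _ _ A0) => j jA; have [Q eQ] := h j jA.
  have [b [e [e0 QE]]] := monomial_divisor (etrans eQ (mulrC _ _)).
  have : 'X_[m j] = (c * e) *: 'X_[a + b] :> {mpoly K[N]}.
    by rewrite eQ PE QE -scalerAr -scalerAl scalerA mulrC mpolyXD.
  move=> /(congr1 (@mlead N K)); rewrite mleadZ ?mulf_neq0 // !mleadXm => ->.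
  exact: lem_addr.
exists (c^-1 *: 'X_[mgcd A m - a]).
by rewrite PE -scalerAl -scalerAr scalerA divff // scale1r -mpolyXD addmC submK.
Qed.

(* Multisets of naturals are represented by sequences. *)
Definition successive_differences (s : seq nat) : seq nat :=
  [seq (p.2 - p.1)%N | p <- zip s (behead s)].

Definition exponent_gaps (N : nat) (J : finType) (m : J -> 'X_{1..N})
    (i : 'I_N) : seq nat :=
  successive_differences (sort leq [seq m j i | j : J]).

(* The variable x_0 is [ord0]; it is exempt from the freeness conditions. *)
Definition free11_collection (n : nat) (J : finType)
    (m : J -> 'X_{1..n.+1}) : Prop :=
  forall i, i != ord0 -> (count_mem 1 (exponent_gaps m i) <= 1)%N.

Definition free_collection (c n : nat) (J : finType)
    (m : J -> 'X_{1..n.+1}) : Prop :=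
  free11_collection m /\
  forall i, i != ord0 ->
    forall d, d \in exponent_gaps m i -> d != 0%N -> ~~ (d <= c)%N.

(* Main.v *)
(* Put U = union over j of the boxes {u in N^n : u_i <= a_(i,j) for all i}.
   The simultaneous rank of a free collection is #|U|.  A gcd of some of the
   M_j is a free collection by itself, and its box is the intersection of
   their boxes, so the formula is inclusion-exclusion for #|U|.

   Comparing coefficients, M_j = sum_k lambda_(j,k) L_k^d says that a weighted
   sum over the points L_k integrates every monomial of degree d to 0 except
   M_j.

   Lower bound: after dehomogenizing by x_0 these equations show that no
   nonzero combination of the monomials with exponents in U vanishes on the
   points with nonzero x_0-coordinate.

   Upper bound: for each i, freeness gives nested sets of nodes
   Z_i(a) with a + 1 elements, for the exponents a of x_i, whose vanishing
   polynomials are x^(a+1) + (terms of degree <= a - c): pass from an exponent a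
   to the next one a' by adjoining the roots of x^(a'-a) - tau.  The points
   (1, z_1, ..., z_n) with z in the union over j of the products of the
   Z_i(a_(i,j)) are #|U| in number, and product weights work for each M_j. *)
Require Import Defs.
From HB Require Import structures.
From mathcomp Require Import all_boot all_order all_algebra.
From mathcomp Require Import boolp reals complex mpoly.
From mathcomp Require Import separable zify.

Set Implicit Arguments.
Unset Strict Implicit.
Unset Printing Implicit Defensive.

Import Order.TTheory GRing.Theory Num.Theory.
Local Open Scope ring_scope.

(** * Coefficients of powers of linear forms *)

Section LinearForms.
Variables (K : fieldType) (N : nat).
Implicit Types (l : 'I_N -> K) (b : 'X_{1..N}).

Definition linear_form l : {mpoly K[N]} := \sum_i l i *: 'X_i.

Lemma linear_form_homog l : linear_form l \is 1.-homog.
Proof. by apply: rpred_sum => i _; apply: rpredZ; rewrite dhomogX /= mdeg1. Qed.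

Lemma homog1_linear_form (L : {mpoly K[N]}) :
  L \is 1.-homog -> L = linear_form (fun i => L@_U_(i)).
Proof.
move=> /dhomogP hL; apply/mpolyP => b; rewrite raddf_sum /=.
have [/eqP/mdeg1P[i /eqP ->]|b1] := eqVneq (mdeg b) 1%N.
  rewrite (bigD1 i) //= big1 => [|k ki]; rewrite mcoeffZ mcoeffXU.
    by rewrite eqxx mulr1 addr0.
  by rewrite (negbTE ki) mulr0.
rewrite big1 => [|i _].
  by apply: memN_msupp_eq0; apply: contra b1 => /hL /= ->.
rewrite mcoeffZ mcoeffX; case: (U_(i)%MM =P b) b1 => [<-|_ _].
  by rewrite mdeg1.
by rewrite mulr0.
Qed.

Lemma mderiv_linear_formX l i d :
  (linear_form l ^+ d.+1)^`M(i) = d.+1%:R * l i *: linear_form l ^+ d.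
Proof.
have dL : (linear_form l)^`M(i) = (l i)%:MP.
  rewrite raddf_sum (bigD1 i) //= big1 => [|k ki]; rewrite mderivZ mderivX mnm1E.
    rewrite eqxx scale1r (_ : (U_(i) - U_(i) = 0)%MM) ?mpolyX0 ?addr0; last first.
      by apply/mnmP => j; rewrite mnmBE subnn mnm0E.
    by rewrite -mul_mpolyC mulr1.
  by rewrite (negbTE ki) scale0r scaler0.
elim: d => [|d IH]; first by rewrite expr1 dL expr0 mul1r -mul_mpolyC mulr1.
rewrite exprS mderivM IH dL mul_mpolyC -scalerAr -exprS -scalerDl.
by congr (_ *: _); rewrite -[LHS]addrC -[X in _ + X]mul1r -mulrDl natr1.
Qed.

(** Multinomial theorem with denominators cleared. Induction on the degree: differentiating in a
    variable [i] with [0 < b i] relates the coefficient at [b] to the one at [b - U_(i)]. *)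
Lemma mcoeff_linear_formX l b :
  (linear_form l ^+ mdeg b)@_b *+ \prod_i (b i)`! =
  (\prod_i l i ^+ b i) *+ (mdeg b)`!.
Proof.
move: {2}(mdeg b) (erefl (mdeg b)) => d hb; rewrite hb.
elim: d b hb => [|d IH] b hb.
  have -> : b = 0%MM by apply/eqP; rewrite -mdeg_eq0 hb.
  rewrite expr0 mcoeff1 eqxx !big1 // => i _; by rewrite ?mnm0E.
have [i hi] : exists i, (0 < b i)%N.
  apply/existsP; apply: contra_eqT hb => /existsPn h.
  by rewrite mdegE big1 // => i _; apply/eqP; rewrite -leqn0 leqNgt.
have le1 : (U_(i) <= b)%MM.
  by apply/mnm_lepP => j; rewrite mnm1E; case: eqP => // <-.
pose a := (b - U_(i))%MM.
have bE : b = (a + U_(i))%MM by rewrite /a submK.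
have ad : mdeg a = d by move: hb; rewrite bE mdegD mdeg1 addn1 => -[].
have biE : b i = (a i).+1 by rewrite bE mnmDE mnm1E eqxx addn1.
have bkE k : k != i -> b k = a k.
  by move=> ki; rewrite bE mnmDE mnm1E eq_sym (negbTE ki) addn0.
have := congr1 (mcoeff a) (mderiv_linear_formX l i d).
rewrite mcoeff_mderiv -bE mcoeffZ => /(congr1 (fun x => x *+ \prod_k (a k)`!)).
rewrite -mulrnA -[in RHS]mulrnAr (IH a ad).
have -> : ((a i).+1 * \prod_k (a k)`! = \prod_k (b k)`!)%N.
  rewrite (bigD1 i) //= [in RHS](bigD1 i) //= biE factS mulnA; congr (_ * _)%N.
  by apply: eq_bigr => k ki; rewrite bkE.
move=> ->; rewrite [in RHS](bigD1 i) //= biE exprS.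
rewrite [X in _ * (X *+ _)](bigD1 i) //=.
under [in RHS]eq_bigr => k ki do rewrite bkE //.
rewrite factS mulrnA mulrnAr; congr (_ *+ _).
by rewrite -[RHS]mulr_natl !mulrA.
Qed.

End LinearForms.

(** * Waring decompositions as moment equations *)

Section Moments.
Variables (K : numFieldType) (N : nat) (J : finType).
Implicit Types (m : J -> 'X_{1..N}) (b : 'X_{1..N}).

Lemma factorials_neq0 b : (\prod_i (b i)`!)%:R != 0 :> K.
Proof.
by rewrite pnatr_eq0 -lt0n prodn_gt0 // => i; rewrite fact_gt0.
Qed.

(** Compare coefficients at each [b] of the right degree; the multinomial coefficients are absorbed
    into the weights [mu]. *)
Lemma waring_decomposableXP m r :
  waring_decomposable (fun j => 'X_[m j] : {mpoly K[N]}) r <->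
  exists (l : 'I_r -> 'I_N -> K) (mu : J -> 'I_r -> K),
    forall j b, mdeg b = mdeg (m j) ->
      \sum_k mu j k * \prod_i l k i ^+ b i = (b == m j)%:R.
Proof.
split=> [[L [la [hL hF]]]|[l [mu h]]].
  exists (fun k i => (L k)@_U_(i)),
    (fun j k => la j k * (mdeg (m j))`!%:R / (\prod_i (m j i)`!)%:R).
  move=> j b hb; have := congr1 (mcoeff b) (hF j).
  rewrite msizeX /= mcoeffX eq_sym raddf_sum /=.
  (* This rescaling fixes the Kronecker delta: the factor is 1 when [b = m j]. *)
  move=> /(congr1 (fun x => x * (\prod_i (b i)`!)%:R / (\prod_i (m j i)`!)%:R)).
  have -> : (b == m j)%:R * (\prod_i (b i)`!)%:R / (\prod_i (m j i)`!)%:R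
     = (b == m j)%:R :> K.
    by case: eqP => [->|_]; rewrite ?mul0r // mul1r divff ?factorials_neq0.
  move=> ->; rewrite -mulrA mulr_suml; apply: eq_bigr => k _.
  have := mcoeff_linear_formX (fun i => (L k)@_U_(i)) b.
  rewrite -(homog1_linear_form (hL k)) -(mulr_natr (_@_b)).
  rewrite -(mulr_natr (\prod_i _)) hb.
  rewrite mcoeffZ => e; rewrite -[in RHS]mulrA [in RHS](mulrA _@_b) e.
  by rewrite !mulrA mulrAC; congr (_ / _); rewrite mulrAC.
exists (fun k => linear_form (l k)),
  (fun j k => mu j k * (\prod_i (m j i)`!)%:R / (mdeg (m j))`!%:R).
split=> [k|j]; first exact: linear_form_homog.
rewrite msizeX /=; apply/mpolyP => b; rewrite raddf_sum /= mcoeffX.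
have [hb|hb] := eqVneq (mdeg b) (mdeg (m j)); last first.
  rewrite big1 => [|k _].
    by case: (m j =P b) hb => // ->; rewrite eqxx.
  rewrite mcoeffZ (_ : _@__ = 0) ?mulr0 //; apply: memN_msupp_eq0.
  have /dhomogP hd : linear_form (l k) ^+ mdeg (m j) \is (mdeg (m j)).-homog.
    by have := dhomogMn (mdeg (m j)) (linear_form_homog (l k)); rewrite mul1n.
  by apply: contra hb => /hd /= ->.
apply: (mulIf (factorials_neq0 b)); rewrite mulr_suml.
transitivity (\sum_k (\prod_i (m j i)`!)%:R * (mu j k * \prod_i l k i ^+ b i)).
  rewrite -mulr_sumr h // [m j == b]eq_sym.
  by case: eqP => [->|_]; rewrite ?mulr1 ?mul1r // mulr0 mul0r.
apply: eq_bigr => k _.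
have := mcoeff_linear_formX (l k) b.
rewrite -(mulr_natr (_@_b)) -(mulr_natr (\prod_i _)) hb mcoeffZ => e.
rewrite -[RHS]mulrA e; set z := (mdeg (m j))`!%:R.
set y := (\prod_i (m j i)`!)%:R.
have z0 : z != 0 by rewrite pnatr_eq0 -lt0n fact_gt0.
by rewrite [RHS]mulrACA mulVf // mulr1 mulrA [y * _]mulrC.
Qed.

End Moments.

(** * Exponent boxes and their union *)

Section Staircase.
Variables (n B : nat) (J : finType).
Implicit Types (m : J -> 'X_{1..n.+1}) (g : 'I_n -> nat).

Definition cons_mnm (a : nat) g : 'X_{1..n.+1} :=
  [multinom if unlift ord0 i is Some k then g k else a | i < n.+1].

Lemma cons_mnm0 a g : cons_mnm a g ord0 = a.
Proof. by rewrite mnmE unlift_none. Qed.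

Lemma cons_mnmS a g k : cons_mnm a g (lift ord0 k) = g k.
Proof. by rewrite mnmE liftK. Qed.

Lemma mdeg_cons_mnm a g : mdeg (cons_mnm a g) = (a + \sum_k g k)%N.
Proof.
rewrite mdegE big_ord_recl cons_mnm0; congr (_ + _)%N.
by apply: eq_bigr => k _; rewrite cons_mnmS.
Qed.

(** Divisors of the dehomogenized monomial. The bound [B] makes the ambient type finite; it cuts
    nothing off once it exceeds the exponents of [a]. *)
Definition box (a : 'X_{1..n.+1}) : {set {ffun 'I_n -> 'I_B}} :=
  [set u : {ffun 'I_n -> 'I_B} | [forall k, (u k <= a (lift ord0 k))%N]].

Definition staircase m := \bigcup_j box (m j).

End Staircase.

(** * Lower bound for the rank *)

Section LowerBound.
Variables (K : numFieldType) (n B : nat) (J : finType).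
Variables (m : J -> 'X_{1..n.+1}) (r : nat).
Hypothesis m0 : forall j, (0 < m j ord0)%N.

(* Monomials with exponents in the staircase are linearly independent on the
   points [l k / l k ord0]: if a combination of them vanishes there, multiply
   it by a monomial that moves a term of top degree to [m j] and integrate
   against the weights of [m j].  Points with [l k ord0 = 0] get weight 0,
   since a positive power of [l k ord0] is left over. *)
Lemma card_staircase_le :
  waring_decomposable (fun j => 'X_[m j] : {mpoly K[n.+1]}) r ->
  (#|staircase B m| <= r)%N.
Proof.
move=> /waring_decomposableXP[l [mu h]].
(* If [l k ord0 = 0] this is 0 by convention, a value that the vanishing weight
   [l k ord0 ^+ mdeg (m j)] hides. *)
pose z k i := l k (lift ord0 i) / l k ord0.
have moment j (g : 'I_n -> nat) : (\sum_i g i < mdeg (m j))%N ->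
    \sum_k mu j k * l k ord0 ^+ mdeg (m j) * \prod_i z k i ^+ g i =
    (cons_mnm (mdeg (m j) - \sum_i g i) g == m j)%:R.
  move=> gd; rewrite -h; last by rewrite mdeg_cons_mnm subnK // ltnW.
  apply: eq_bigr => k _; rewrite -mulrA; congr (_ * _).
  rewrite big_ord_recl cons_mnm0.
  have [l0|l0] := eqVneq (l k ord0) 0.
    by rewrite l0 !expr0n gtn_eqF ?(leq_ltn_trans _ gd) // subn_eq0 leqNgt gd !mul0r.
  rewrite -{1}(subnK (ltnW gd)) exprD -mulrA; congr (_ * _).
  rewrite -prodrXr -big_split; apply: eq_bigr => i _ /=.
  by rewrite cons_mnmS -exprMn /z mulrC divfK.
set S := staircase B m.
pose e (p : 'I_#|S|) : {ffun 'I_n -> 'I_B} := enum_val p.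
pose wt (p : 'I_#|S|) := (\sum_i e p i)%N.
pose A : 'M[K]_(#|S|, r) := \matrix_(p, k) \prod_i z k i ^+ e p i.
suff /eqP <- : row_free A by apply: rank_leq_col.
apply: inj_row_free => v vA; apply/eqP; apply: contraT.
move=> /rV0Pn[p0 vp0].
case: (@arg_maxnP _ p0 (fun p => v 0 p != 0) wt vp0) => p vp pmax.
have : e p \in S by apply: enum_valP.
move=> /bigcupP[j _]; rewrite inE => /forallP up.
pose q i := (m j (lift ord0 i) - e p i)%N.
pose g (s : 'I_#|S|) i := (q i + e s i)%N.
have mdE : mdeg (m j) = (m j ord0 + \sum_(i < n) m j (lift ord0 i))%N.
  by rewrite mdegE big_ord_recl.
have gp i : g p i = m j (lift ord0 i) by rewrite /g subnK.
(* Maximality of [p] bounds the degree, and the positive exponent of x_0 in [m j] makes the bound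
   strict, as [moment] requires. *)
have gs s : v 0 s != 0 -> (\sum_i g s i < mdeg (m j))%N.
  move=> vs; rewrite mdE -[X in (X < _)%N]add0n -addSn leq_add //.
  under [leqRHS]eq_bigr => i _ do rewrite -gp.
  by rewrite !big_split /= leq_add2l; apply: pmax.
have /eqP : \sum_k mu j k * l k ord0 ^+ mdeg (m j) *
    (\prod_i z k i ^+ q i * (v *m A) 0 k) = 0.
  by rewrite vA big1 // => k _; rewrite mxE !mulr0.
suff -> : \sum_k mu j k * l k ord0 ^+ mdeg (m j) *
    (\prod_i z k i ^+ q i * (v *m A) 0 k) = v 0 p by rewrite (negbTE vp).
transitivity (\sum_s v 0 s * \sum_k mu j k * l k ord0 ^+ mdeg (m j) *
    \prod_i z k i ^+ g s i).
  under [RHS]eq_bigr => s _ do rewrite mulr_sumr.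
  rewrite exchange_big; apply: eq_bigr => k _ /=.
  rewrite mxE !mulr_sumr; apply: eq_bigr => s _; rewrite mxE.
  under [in RHS]eq_bigr => i _ do rewrite exprD.
  by rewrite big_split /= [in RHS]mulrCA; congr (_ * _); rewrite mulrCA.
rewrite (bigD1 p) //= moment ?gs // [X in _ + X]big1 ?addr0 => [|s sp].
  suff -> : cons_mnm (mdeg (m j) - \sum_i g p i) (g p) = m j by rewrite eqxx mulr1.
  apply/mnmP => i.
  case: (unliftP ord0 i) => [i'|] ->; first by rewrite cons_mnmS gp.
  by rewrite cons_mnm0 mdE; under eq_bigr => i' _ do rewrite gp; rewrite addnK.
have [->|vs] := eqVneq (v 0 s) 0; first by rewrite mul0r.
rewrite moment ?gs //; case: eqP => [E|_]; last by rewrite mulr0.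
case/eqP: sp; apply: enum_val_inj; apply/ffunP => i; apply: val_inj => /=.
have /= := congr1 (fun x : 'X_{1..n.+1} => x (lift ord0 i)) E.
by rewrite cons_mnmS -gp => /addnI.
Qed.
End LowerBound.

(** * Inclusion-exclusion over gcds *)

Section InclusionExclusion.
Variables (n B : nat) (J : finType) (m : J -> 'X_{1..n.+1}).

(** Membership in a box is divisibility by a monomial free of x_0, so this is the universal property
    of the gcd. *)
Lemma mem_box_mgcd (A : {set J}) u : A != set0 ->
  (u \in box B (mgcd A m)) = (A \subset [set j | u \in box B (m j)]).
Proof.
have box_le (a : 'X_{1..n.+1}) :
    (u \in box B a) = (cons_mnm 0 (fun k => u k) <= a)%MM.
  rewrite inE; apply/forallP/mnm_lepP => h i.
    by case: (unliftP ord0 i) => [k|] ->; rewrite ?cons_mnmS // cons_mnm0.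
  by rewrite -(cons_mnmS 0 (fun k => u k)); apply: h.
move=> A0; rewrite box_le; apply/idP/subsetP => [/mgcdP h j jA|h].
  by rewrite inE box_le; apply: h.
by apply/mgcdP => // j /h; rewrite inE box_le.
Qed.

Lemma card_staircase :
  #|staircase B m|%:Z =
  \sum_(A : {set J} | A != set0) (-1) ^+ (#|A|.+1) * #|box B (mgcd A m)|%:Z.
Proof.
have card_indicator (S : {set {ffun 'I_n -> 'I_B}}) : #|S|%:Z = \sum_u (u \in S)%:R.
  rewrite -natz -sum1_card natr_sum big_mkcond /=; apply: eq_bigr => u _.
  by case: (u \in S).
rewrite [LHS]card_indicator.
under [RHS]eq_bigr => A _ do rewrite (card_indicator (box B _)) mulr_sumr.
rewrite exchange_big; apply: eq_bigr => u _ /=.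
pose T := [set j | u \in box B (m j)].
under eq_bigr => A A0 do rewrite mem_box_mgcd //.
(* For a fixed [u], the subset [A] contributes (-1)^|A| if it lies in [T] and 0 otherwise; the empty
   set contributes 1. The product is 0 when some box contains [u], and 1 when none does. *)
have /esym : \prod_j (- (j \in T)%:R + 1) =
    \sum_(A : {set J}) \prod_j (if j \in A then - (j \in T)%:R else 1) :> int.
  exact: bigA_distr.
rewrite (bigD1 set0) //= big1 => [|j _]; last by rewrite inE.
under eq_bigr => A _.
  rewrite -big_mkcond prodrN /= (_ : \prod_(i in A) _ = (A \subset T)%:R); last first.
    have [/subsetP AT|/subsetPn[j jA jT]] := boolP (A \subset T).
      by apply: big1 => j /AT ->.
    by rewrite (bigD1 j) //= (negbTE jT) mul0r.
  over.
move=> E; under eq_bigr => A _ do rewrite exprS mulN1r mulNr.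
rewrite sumrN; apply/esym/eqP; rewrite eqr_oppLR -subr_eq0 opprK addrC.
rewrite -(inj_eq (addrI 1)) addrCA E addr0; apply/eqP.
have [/bigcupP[j _ ju]|uN] := boolP (u \in staircase B m).
  by rewrite (bigD1 j) //= inE ju subrr mul0r.
rewrite big1 ?subr0 // => j _; rewrite inE.
case: (boolP (u \in _)) => ju; rewrite ?subr0 ?addNr ?oppr0 ?add0r //.
by case/negP: uN; apply/bigcupP; exists j.
Qed.
End InclusionExclusion.

(** * Nodes with lacunary vanishing polynomial, and their weights *)

Section LacunaryNodes.
Variables (K : numClosedFieldType) (c : nat).
Implicit Types s t : seq K.

Definition lacunary s := exists2 q : {poly K},
  (size q <= size s - c)%N & \prod_(x <- s) ('X - x%:P) = 'X^(size s) + q.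

(** Take tau larger than |x|^d for every x in [s]: the roots of X^d - tau then avoid [s], and they
    are distinct because tau is nonzero. *)
Lemma fresh_radicals s d : (0 < d)%N -> exists t tau,
  [/\ size t = d, uniq t, ~~ has (mem s) t
    & \prod_(x <- t) ('X - x%:P) = 'X^d - tau%:P :> {poly K}].
Proof.
move=> d0; pose M := 1 + \sum_(x <- s) `|x| ^+ d.
have M0 : 0 < M by rewrite ltr_pwDl // sumr_ge0 // => x _; apply: exprn_ge0.
have pM : ('X^d - M%:P : {poly K}) \is monic.
  rewrite monicE lead_coefDl ?lead_coefXn // size_polyXn size_polyN.
  exact: leq_ltn_trans (size_polyC_leq1 _) _.
have [t tE] := closed_field_poly_normal ('X^d - M%:P : {poly K}).
rewrite (monicP pM) scale1r in tE.
have tM x : x \in t -> x ^+ d = M.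
  by rewrite -root_prod_XsubC -tE => /rootP/eqP; rewrite !hornerE subr_eq0 => /eqP.
exists t, M; split=> //.
- apply: succn_inj; rewrite -(size_prod_XsubC t id) -tE.
  rewrite size_polyDl ?size_polyXn // size_polyN.
  exact: leq_ltn_trans (size_polyC_leq1 _) _.
- rewrite -separable_prod_XsubC -tE unlock.
  rewrite derivB derivC subr0 derivXn -scaler_nat coprimepZr ?pnatr_eq0 -?lt0n //.
  rewrite coprimep_expr // coprimepX.
  by rewrite /root !hornerE expr0n gtn_eqF // sub0r oppr_eq0 gt_eqF.
- apply/hasPn => x xt; apply/negP => /= xs.
  suff : `|x| ^+ d < M.
    by rewrite -normrX (tM _ xt) gtr0_norm ?ltxx.
  rewrite /M (big_rem x) //= addrCA ltrDl ltr_pwDl // sumr_ge0 // => y _.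
  exact: exprn_ge0.
Qed.

(** In the product (X^|s| + q)(X^|t| - tau), the terms carrying tau have degree at most |s|, which
    is small enough because |t| > c. *)
Lemma lacunary_cat s t tau : lacunary s -> (c < size t)%N ->
  \prod_(x <- t) ('X - x%:P) = 'X^(size t) - tau%:P -> lacunary (s ++ t).
Proof.
move=> [q qs sE] ct tE; exists (q * 'X^(size t) - tau *: ('X^(size s) + q)).
  apply: (leq_trans (size_polyD _ _)); rewrite size_polyN geq_max size_cat.
  apply/andP; split.
    have [->|] := eqVneq q 0; first by rewrite mul0r size_poly0.
    rewrite -size_poly_gt0 => q0.
    by apply: leq_trans (size_polyMleq _ _) _; rewrite size_polyXn; lia.
  apply: leq_trans (size_scale_leq _ _) (leq_trans (size_polyD _ _) _).
  rewrite size_polyXn geq_max; apply/andP; split; last apply: (leq_trans qs); lia.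
rewrite big_cat /= sE tE size_cat exprD mulrBr !mulrDl -!addrA; congr (_ + _).
by rewrite -mul_polyC [tau%:P * _]mulrC mulrDl.
Qed.

(** The entries of [e] are the node counts a + 1. Taking prefixes of a single list makes the node
    sets nested; each strict jump exceeds c and is filled with fresh radicals. *)
Lemma lacunary_nodes (e : seq nat) :
  path (fun p q => (p == q) || (p + c < q)%N) 0 e ->
  exists2 s, uniq s &
    {in e, forall p, (p <= size s)%N /\ lacunary (take p s)}.
Proof.
suff ext s : uniq s -> lacunary s ->
    path (fun p q => (p == q) || (p + c < q)%N) (size s) e ->
    exists2 t, uniq (s ++ t) &
      {in e, forall p, (p <= size (s ++ t))%N /\ lacunary (take p (s ++ t))}.
  move=> /(ext [::])[||t] //; last by exists t.
  by exists 0; rewrite ?size_poly0 // big_nil addr0.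
elim: e s => [|q e IH] s us ls /=; first by exists [::]; rewrite ?cats0.
move=> /andP[/predU1P[<- /(IH s us ls)[t ut ht]|lt pe]].
  exists t => // p; rewrite inE => /predU1P[->|/ht//].
  by rewrite size_cat leq_addr take_size_cat.
have [|t1 [tau [t1s ut1 st1 t1E]]] := @fresh_radicals s (q - size s); first by lia.
have qE : q = size (s ++ t1) by rewrite size_cat t1s; lia.
have l1 : lacunary (s ++ t1).
  by apply: (@lacunary_cat _ _ tau) => //; rewrite t1s //; lia.
rewrite qE in pe.
have [|t ut ht] := IH (s ++ t1) _ l1 pe.
  by rewrite cat_uniq us st1 ut1.
exists (t1 ++ t); rewrite catA // => p; rewrite inE => /predU1P[->|/ht//].
by rewrite qE; split; [rewrite [leqRHS]size_cat leq_addr|rewrite take_size_cat].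
Qed.

(* Below degree [a] this is a Vandermonde system; on the nodes [x ^+ a.+1]
   is a combination of powers below [a.+1 - c], so the [c] further moments
   involve only powers below [a] and vanish. *)
Lemma lacunary_weights s a : uniq s -> lacunary s -> size s = a.+1 ->
  (c <= a)%N ->
  exists w : nat -> K, forall b, (b <= a + c)%N ->
    \sum_(k < a.+1) w k * s`_k ^+ b = (b == a)%:R.
Proof.
move=> us [q qs sE] ss ca.
pose V := Vandermonde a.+1 (\row_(k < a.+1) s`_k).
have Vu : V \in unitmx.
  rewrite unitmxE det_Vandermonde unitfE; apply/prodf_neq0 => i _.
  apply/prodf_neq0 => j ltij.
  by rewrite !mxE subr_eq0 nth_uniq ?ss // gtn_eqF.
pose w : 'cV[K]_a.+1 := invmx V *m delta_mx ord_max 0.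
have low b : (b <= a)%N -> \sum_(k < a.+1) w k 0 * s`_k ^+ b = (b == a)%:R.
  rewrite -ltnS => ba.
  have /matrixP/(_ (Ordinal ba) 0) : V *m w = delta_mx ord_max 0 by rewrite mulKVmx.
  rewrite !mxE andbT -val_eqE /= => <-; apply: eq_bigr => k _.
  by rewrite !mxE mulrC.
exists (fun k => w (inord k) 0) => b bac.
under eq_bigr => k _ do rewrite inord_val.
have [/low//|ab] := leqP b a.
pose f := q * 'X^(b - a.+1).
have fs : (size f <= a)%N.
  by apply: leq_trans (size_polyMleq _ _) _; rewrite size_polyXn; lia.
have sf (k : 'I_a.+1) : s`_k ^+ b = - f.[s`_k].
  have : root (\prod_(x <- s) ('X - x%:P)) s`_k.
    by rewrite root_prod_XsubC mem_nth ?ss.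
  rewrite sE ss => /rootP; rewrite !hornerE => /(canRL (addrK _)).
  by rewrite sub0r -{1}(subnKC ab) exprD => ->; rewrite mulNr.
under eq_bigr => k _.
  rewrite sf (horner_coef_wide _ fs) mulrN mulr_sumr.
  over.
rewrite sumrN exchange_big big1 ?oppr0 /= ?gtn_eqF // => i _.
under eq_bigr => k _ do rewrite mulrCA.
by rewrite -mulr_sumr low 1?ltnW // ltn_eqF // mulr0.
Qed.

End LacunaryNodes.

Lemma lift0_neq0 n (i : 'I_n) : lift ord0 i != ord0.
Proof. by rewrite eq_sym neq_lift. Qed.

(** * Upper bound, and the rank of a free collection *)

Section Rank.
Variables (K : numClosedFieldType) (n c B : nat) (J : finType).
Variable m : J -> 'X_{1..n.+1}.
Hypothesis m_x0 : forall j, m j ord0 = c.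
Hypothesis m_ge : forall i j, i != ord0 -> (c <= m j i)%N.
Hypothesis m_lt : forall i j, (m j i < B)%N.
Hypothesis m_free : free_collection c m.

(** Freeness makes the nonzero gaps exceed c; the initial jump from 0 to a + 1 does so because a >=
    c. *)
Lemma gap_path i : i != ord0 ->
  path (fun p q => (p == q) || (p + c < q)%N) 0
    [seq a.+1 | a <- sort leq [seq m j i | j : J]].
Proof.
move=> i0; set s := sort _ _.
have s_ge : {in s, forall a, c <= a}%N.
  by move=> a; rewrite mem_sort => /imageP[j _ ->]; apply: m_ge.
have gaps : {in successive_differences s, forall d, (d == 0) || (c < d)}%N.
  move=> d ds; have [//|d0] := eqVneq d 0%N.
  by rewrite ltnNge; apply: (m_free.2 i i0).
have := sort_sorted leq_total [seq m j i | j : J]; rewrite -/s.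
case: s s_ge gaps => //= a s s_ge gaps sa.
rewrite ltnS (s_ge a (mem_head _ _)) /= path_map {s_ge}.
elim: s a gaps sa => //= b s IH a gaps /andP[ab sb].
apply/andP; split; last first.
  by apply: (IH b) => // d ds; apply: gaps; rewrite inE ds orbT.
by have := gaps (b - a)%N (mem_head _ _); rewrite /=; lia.
Qed.

Lemma waring_decomposable_staircase :
  waring_decomposable (fun j => 'X_[m j] : {mpoly K[n.+1]}) #|staircase B m|.
Proof.
have /choice[z zP] (i : 'I_n) : exists s : seq K, uniq s /\
    forall j, (m j (lift ord0 i) < size s)%N /\
      lacunary c (take (m j (lift ord0 i)).+1 s).
  have [s us hs] := lacunary_nodes K (gap_path (lift0_neq0 i)).
  exists s; split=> // j; apply: hs; apply: map_f; rewrite mem_sort.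
  exact: (image_f (fun j => m j (lift ord0 i))).
have /choice[w wP] (ji : J * 'I_n) : exists w : nat -> K,
    forall b, (b <= m ji.1 (lift ord0 ji.2) + c)%N ->
    \sum_(k < (m ji.1 (lift ord0 ji.2)).+1) w k * (z ji.2)`_k ^+ b =
    (b == m ji.1 (lift ord0 ji.2))%:R.
  case: ji => j i /=; have [us /(_ j)[ms ls]] := zP i.
  have [|w hw] := lacunary_weights (take_uniq _ us) ls (size_takel ms).
    exact: m_ge (lift0_neq0 i).
  exists w => b /hw <-; apply: eq_bigr => k _.
  by rewrite nth_take.
pose S := staircase B m.
pose e (k : 'I_#|S|) : {ffun 'I_n -> 'I_B} := enum_val k.
apply/waring_decomposableXP.
exists (fun k i => if unlift ord0 i is Some i' then (z i')`_(e k i') else 1),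
  (fun j k => if e k \in box B (m j) then \prod_i w (j, i) (e k i) else 0).
move=> j b hb.
pose G (u : {ffun 'I_n -> 'I_B}) i :=
  w (j, i) (u i) * (z i)`_(u i) ^+ b (lift ord0 i).
transitivity (\sum_(u in box B (m j)) \prod_i G u i).
  transitivity (\sum_(u in S) if u \in box B (m j) then \prod_i G u i else 0).
    rewrite [RHS]big_enum_val; apply: eq_bigr => k _.
    rewrite -/(e k); case: ifP; rewrite ?mul0r // big_ord_recl unlift_none.
    rewrite expr1n mul1r.
    by rewrite -big_split => _; apply: eq_bigr => i _; rewrite liftK.
  rewrite -big_mkcondr; apply: eq_bigl => u.
  by apply: andb_idl => uj; apply/bigcupP; exists j.
pose M (i : 'I_n) := m j (lift ord0 i).
(* Product weights on a product grid: the moment factors into one-variable moments. *)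
transitivity (\prod_i \sum_(k < (M i).+1) w (j, i) k * (z i)`_k ^+ b (lift ord0 i)).
  pose F i k := w (j, i) k * (z i)`_k ^+ b (lift ord0 i).
  transitivity (\prod_i \sum_(k < B | (k < (M i).+1)%N) F i k).
    rewrite bigA_distr_big_dep; apply: eq_bigl => u.
    by rewrite inE; apply/forallP/familyP.
  by apply: eq_bigr => i _; rewrite -(big_ord_widen _ (F i) (m_lt _ _)).
have wM (i : 'I_n) d : (d <= M i + c)%N ->
    \sum_(k < (M i).+1) w (j, i) k * (z i)`_k ^+ d = (d == M i)%:R := wP (j, i) d.
have degE : (b ord0 + \sum_i b (lift ord0 i) = c + \sum_i M i)%N.
  by move: hb; rewrite !mdegE !big_ord_recl m_x0.
have [/forallP bM|bM] := boolP [forall i, b (lift ord0 i) == M i].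
  rewrite big1 => [|i _]; last by rewrite wM (eqP (bM i)) ?leq_addr // eqxx.
  suff -> : b = m j by rewrite eqxx.
  apply/mnmP => i; case: (unliftP ord0 i) => [i'|] ->; first exact/eqP.
  move: degE; under eq_bigr => i' _ do rewrite (eqP (bM i')).
  by rewrite m_x0 => /addIn.
have -> : (b == m j) = false.
  by apply: contraNF bM => /eqP ->; apply/forallP.
have [/forallP bM'|bM'] := boolP [forall i, (M i <= b (lift ord0 i))%N]; last first.
  have /forallPn[i bi] := bM'.
  rewrite -ltnNge in bi; rewrite (bigD1 i) //= wM ?ltn_eqF ?mul0r //.
  exact: leq_trans (ltnW bi) (leq_addr _ _).
(* Every exponent of [b] is now at least that of [m j], and the total degrees agree, so the excess
   at [i] is at most the c available from x_0. The factor at [i] is thus one of the vanishing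
   moments up to [M i + c]. *)
have /forallPn[i bi] := bM.
rewrite (bigD1 i) //= wM ?(negbTE bi) ?mul0r //; rewrite -/(M i).
move: degE; rewrite (bigD1 i) //= [in RHS](bigD1 i) //=.
have arith p q r x y : (y <= x -> p + (q + x) = c + (r + y) -> q <= r + c)%N by lia.
by apply: arith; apply: leq_sum => k _.
Qed.

Lemma simultaneous_waring_rankX : (0 < c)%N ->
  simultaneous_waring_rank (fun j => 'X_[m j] : {mpoly K[n.+1]}) = #|staircase B m|.
Proof.
move=> c0.
have [|h hmin] := @simultaneous_waring_rankP K n.+1 J (fun j => 'X_[m j]).
  by move=> j; apply/homogP; exists (mdeg (m j)); rewrite dhomogX.
apply/eqP; rewrite eqn_leq hmin; last exact: waring_decomposable_staircase.
by rewrite (card_staircase_le B _ h) // => j; rewrite m_x0.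
Qed.
End Rank.

(** * Single monomials and the final formula *)

Lemma free_collection_unit c n (a : 'X_{1..n.+1}) :
  free_collection c (fun _ : unit => a).
Proof.
have gaps0 i : exponent_gaps (fun _ : unit => a) i = [::].
  rewrite /exponent_gaps; set s := sort _ _.
  have : size s = 1%N by rewrite size_sort size_image card_unit.
  by case: s => [|x []].
by split=> i _; rewrite gaps0.
Qed.

Lemma waring_rankX (K : numClosedFieldType) n c B (a : 'X_{1..n.+1}) :
  (0 < c)%N -> a ord0 = c -> (forall i, c <= a i < B)%N ->
  waring_rank ('X_[a] : {mpoly K[n.+1]}) = #|box B a|.
Proof.
move=> c0 a0 ha; rewrite /waring_rank.
rewrite (@simultaneous_waring_rankX K n c B unit (fun _ => a)) //.
- apply: eq_card => u; apply/bigcupP/idP => [[]//|ua].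
  by exists tt.
- by move=> i _ _; case/andP: (ha i).
- by move=> i _; case/andP: (ha i).
- exact: free_collection_unit.
Qed.

(* [R[i]] for a [realType] R is the field of complex numbers; [m j] is
   the exponent vector of the monomial M_j. *)
Theorem proposition3p4 (R : realType) (n c : nat) (J : finType)
    (m : J -> 'X_{1..n.+1})
    (c_ge1 : (1 <= c)%N)
    (J_nonempty : (0 < #|J|)%N)
    (m_x0 : forall j : J, m j ord0 = c)
    (m_ge : forall (i : 'I_n.+1) (j : J), i != ord0 -> (c <= m j i)%N)
    (m_free : free_collection c m) :
  (simultaneous_waring_rank (fun j : J => 'X_[m j] : {mpoly R[i][n.+1]}))%:Z =
  \sum_(A : {set J} | A != set0)
    (-1) ^+ (#|A|.+1) * (waring_rank ('X_[mgcd A m] : {mpoly R[i][n.+1]}))%:Z.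
Proof.
(* The total degree bounds every exponent, so no box is truncated. *)
pose B := (\max_j mdeg (m j)).+1.
have m_lt i j : (m j i < B)%N.
  rewrite ltnS; apply: leq_trans (leq_bigmax j).
  by rewrite mdegE (bigD1 i) //= leq_addr.
rewrite (simultaneous_waring_rankX _ m_x0 m_ge m_lt m_free) // card_staircase.
apply: eq_bigr => A A0; congr (_ * (_)%:Z).
have [j jA] := set0Pn _ A0.
have gle i : (mgcd A m i <= m j i)%N.
  by apply: (mnm_lepP ((mgcdP m _ A0).1 (lepm_refl _) j jA) i).
(* The monomial with all exponents c divides every M_j, hence their gcd; with [gle] this gives the
   gcd x_0-exponent exactly c. *)
have gge i : (c <= mgcd A m i)%N.
  suff /mnm_lepP/(_ i) : (cons_mnm c (fun _ : 'I_n => c) <= mgcd A m)%MM.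
    by case: (unliftP ord0 i) => [k|] ->; rewrite ?cons_mnm0 ?cons_mnmS.
  apply/mgcdP => // k _; apply/mnm_lepP => i'.
  case: (unliftP ord0 i') => [l|] ->; rewrite ?cons_mnm0 ?cons_mnmS ?m_x0 //.
  exact: m_ge (lift0_neq0 _).
rewrite (@waring_rankX _ n c B) // => [|i].
  by apply/eqP; rewrite eqn_leq gge -(m_x0 j) gle.
by rewrite gge (leq_ltn_trans (gle i)).
Qed.
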